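(* For all $k\in\mathbb{N}^+$, if $R\subseteq X\times Y$ is a $(k,1)$-semi-equation, then $R$ satisfies $\delta$-sEH for $\delta=1/6^{k-1}$.
   Context: $\mathbb{N}^+=\{1,2,\dots\}$, $[k]=\{1,\dots,k\}$; $X,Y$ are arbitrary sets. For $R\subseteq X\times Y$ and $y\in Y$, $R_y:=\{x\in X:(x,y)\in R\}$. $R\subseteq X\times Y$ is a $(k,1)$-semi-equation if for all $y_1,\dots,y_k\in Y$ with $\bigcap_{i\in[k]}R_{y_i}\neq\emptyset$ there are distinct $i,j\in[k]$ such that $R_{y_i}\subseteq R_{y_j}$. For $\delta>0$, $R\subseteq X\times Y$ satisfies the $\delta$-strong Erdős–Hajnal property ($\delta$-sEH) if for all finite $A\subseteq X$ and $B\subseteq Y$ there are $A_0\subseteq A$ and $B_0\subseteq B$ with $|A_0|\geq\delta|A|$ and $|B_0|\geq\delta|B|$ such that $R\cap(A_0\times B_0)$ is either $A_0\times B_0$ or $\emptyset$. *)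

(* Defs.v *)
From mathcomp Require Export all_boot all_order all_algebra finmap.
From mathcomp Require Export all_classical reals.

Set Implicit Arguments.
Unset Strict Implicit.
Unset Printing Implicit Defensive.

Import Order.TTheory GRing.Theory Num.Theory.

Local Open Scope classical_set_scope.
Local Open Scope ring_scope.

(* The (k,1)-semi-equations. *)
Definition semi_equation1 (X Y : Type) (k : nat) (R : set (X * Y)) : Prop :=
  forall y : 'I_k -> Y,
    \bigcap_(i in [set: 'I_k]) ysection R (y i) !=set0 ->
    exists i j : 'I_k, i <> j /\ ysection R (y i) `<=` ysection R (y j).

(* [{classic X}] is [X] itself with the choice structure given by the axiom of
   choice, so [{fset {classic X}}] is the type of finite subsets of an
   arbitrary [X].  The definition is meant for [0 < delta]. *)
Definition strong_EH (K : realType) (delta : K) (X Y : Type)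
    (R : set (X * Y)) : Prop :=
  forall (A : {fset {classic X}}) (B : {fset {classic Y}}),
    exists (A0 : {fset {classic X}}) (B0 : {fset {classic Y}}),
      [/\ (A0 `<=` A)%fset,
          (B0 `<=` B)%fset,
          delta * #|` A|%:R <= #|` A0|%:R,
          delta * #|` B|%:R <= #|` B0|%:R &
          R `&` ([set` A0] `*` [set` B0]) = [set` A0] `*` [set` B0] \/
          R `&` ([set` A0] `*` [set` B0]) = set0].

(* Main.v *)
Require Import Defs.
From mathcomp Require Import zify.

(* Restrict to finite sides S and T, and call a family of fibers through a
   common point an antichain when no two are nested; the hypothesis bounds the
   size of such antichains by k - 1.  Induct on this bound: if U is a union of
   fibers, the fibers incomparable to each of those forming U satisfy the bound
   k - 2 on U.  So it suffices to find U covering a sixth of S with a sixth of T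
   incomparable to it, or else a homogeneous pair directly.
   If at least a third of the fibers are small (less than |S| / 6), add small
   fibers to U by decreasing size until U covers a sixth of S, hence at most a
   third; each small fiber is then contained in U, so disjoint from S \ U, or
   incomparable to the fibers forming U, and one of the two cases is that of a
   sixth of T.  Otherwise take for U a smallest large fiber: each other large
   fiber contains U or is incomparable to it. *)

Set Implicit Arguments.
Unset Strict Implicit.
Unset Printing Implicit Defensive.

Import Order.TTheory GRing.Theory Num.Theory.

Local Open Scope classical_set_scope.
Local Open Scope ring_scope.

Section FiniteRelation.
Local Open Scope nat_scope.
Variables (A B : finType) (r : A -> B -> bool).
Implicit Types (S U : {set A}) (T C : {set B}).

Definition fiber S (y : B) : {set A} := [set x in S | r x y]%SET.

Definition fiber_union S C : {set A} := (\bigcup_(c in C) fiber S c)%SET.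

Definition antichain S C : Prop :=
  forall y z, y \in C -> z \in C -> y != z -> ~~ (fiber S y \subset fiber S z).

Definition incomparable S (y z : B) : bool :=
  ~~ (fiber S y \subset fiber S z) && ~~ (fiber S z \subset fiber S y).

(** The finite counterpart of a [(k + 1, 1)]-semi-equation: indices range over [T], points and
    fibers are cut down to [S]. *)
Definition width_le S T (k : nat) : Prop :=
  forall x C, x \in S -> C \subset T -> (forall y, y \in C -> r x y) ->
    antichain S C -> #|C| <= k.

Definition homogeneous_pair S T (d : nat) : Prop :=
  exists S0 T0, [/\ S0 \subset S, T0 \subset T, #|S| <= d * #|S0|,
    #|T| <= d * #|T0| &
    {in S0 & T0, forall x y, r x y} \/ {in S0 & T0, forall x y, ~~ r x y}].

Lemma fiber_sub S y : fiber S y \subset S.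
Proof. by apply/fintype.subsetP => x; rewrite inE => /andP[]. Qed.

Lemma fiber_union_sub S C : fiber_union S C \subset S.
Proof. by apply/bigcupsP => c _; exact: fiber_sub. Qed.

Lemma fiberS S U y z : U \subset S ->
  fiber S y \subset fiber S z -> fiber U y \subset fiber U z.
Proof.
move=> US /fintype.subsetP yz; apply/fintype.subsetP => x.
rewrite !inE => /andP[xU xy]; rewrite xU /=.
by have := yz x; rewrite !inE (fintype.subsetP US x xU) xy => /(_ isT).
Qed.

Lemma homogeneous_pairS S S1 T T1 d : S1 \subset S -> T1 \subset T ->
  #|S| <= 6 * #|S1| -> #|T| <= 6 * #|T1| ->
  homogeneous_pair S1 T1 d -> homogeneous_pair S T (6 * d).
Proof.
move=> S1S T1T cS cT [S0 [T0 [S0S T0T cS0 cT0 h]]].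
exists S0, T0; split => //.
- exact: fintype.subset_trans S1S.
- exact: fintype.subset_trans T1T.
- by apply: leq_trans cS _; rewrite -mulnA leq_mul2l.
- by apply: leq_trans cT _; rewrite -mulnA leq_mul2l.
Qed.

(* An antichain of fibers through a point of [fiber S c] that are incomparable
   to [fiber S c] can be enlarged by [c]. *)
Lemma width_le_incomparable S T C k : C \subset T -> width_le S T k.+1 ->
  width_le (fiber_union S C)
    [set y in T | [forall c in C, incomparable S c y]]%SET k.
Proof.
move=> CT w x D /bigcupP[c cC]; rewrite inE => /andP[xS xc] DT xD aD.
have inc y : y \in D -> incomparable S c y.
  by move=> /(fintype.subsetP DT); rewrite inE => /andP[_ /forall_inP]; apply.
have cD : c \notin D.
  by apply/negP => /inc; rewrite /incomparable fintype.subxx.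
have := w x (c |: D)%SET xS; rewrite cardsU1 cD add1n ltnS; apply.
- rewrite finset.subUset finset.sub1set (fintype.subsetP CT c cC) /=.
  by apply/fintype.subsetP => y /(fintype.subsetP DT); rewrite inE => /andP[].
- by move=> y /setU1P[->//|/xD].
- move=> y z /setU1P[->|yD] /setU1P[->|zD] yz.
  + by rewrite eqxx in yz.
  + by case/andP: (inc _ zD).
  + by case/andP: (inc _ yD).
  (* Inclusions pass to subsets, so fibers not nested on the union are not nested on [S]. *)
  + apply/negP => /(fiberS (fiber_union_sub S C)).
    exact/negP/aD.
Qed.

Lemma width_leS S T T' k : T' \subset T -> width_le S T k -> width_le S T' k.
Proof.
by move=> TT w x C xS CT; apply: w => //; exact: fintype.subset_trans TT.
Qed.

Lemma homogeneous_pair_self S T d : 0 < d ->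
  {in S & T, forall x y, r x y} \/ {in S & T, forall x y, ~~ r x y} ->
  homogeneous_pair S T d.
Proof. by move=> d0 h; exists S, T; split=> //; rewrite leq_pmull. Qed.

(** The inequality is strict, so ties are free and removing any one smallest fiber preserves
    closure. *)
Definition up_closed S T C : bool :=
  [forall y in C, forall z in T,
    (#|fiber S y| < #|fiber S z|) ==> (z \in C)].

(** If the fiber of [z] leaves the union, then [z] is not in [C], so by closure its fiber is at most
    as large as each fiber from [C]. Containing one of them would force equality, and being
    contained in one would put it inside the union. *)
Lemma up_closed_split S T C z : up_closed S T C -> z \in T ->
  fiber S z \subset fiber_union S C \/ {in C, forall c, incomparable S c z}.
Proof.
move=> /forall_inP uC zT; case: (boolP (fiber S z \subset _)); first by left.
move=> nz; right => c cC; have cU : fiber S c \subset fiber_union S C.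
  exact: (finset.bigcup_sup c).
have zC : z \notin C by apply: contra nz => zC; exact: (finset.bigcup_sup z).
have zc : #|fiber S z| <= #|fiber S c|.
  by rewrite leqNgt; apply: contra zC; move/forall_inP: (uC c cC) => /(_ z zT)/implyP.
apply/andP; split; apply: contra nz => h; last exact: fintype.subset_trans cU.
suff <- : fiber S c = fiber S z by [].
by apply/eqP; rewrite eqEcard h.
Qed.

Lemma exists_smallest_fiber S C c0 : c0 \in C ->
  exists2 c, c \in C & {in C, forall d, #|fiber S c| <= #|fiber S d|}.
Proof.
by move=> /(arg_minnP (fun c => #|fiber S c|)) [c cC minc]; exists c.
Qed.

(* A minimal upward closed family whose fibers cover a sixth of [S] does not
   cover more than a third: it exceeds by one small fiber a family covering
   less than a sixth. *)
Lemma small_fibers_cover S T :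
  (forall y, y \in T -> 6 * #|fiber S y| < #|S|) ->
  exists C, [/\ C \subset T, up_closed S T C,
    6 * #|fiber_union S C| <= 2 * #|S| &
    #|S| <= 6 * #|fiber_union S C| \/
    {in T, forall y, fiber S y \subset fiber_union S C}].
Proof.
move=> small.
pose P C := [&& C \subset T, up_closed S T C & #|S| <= 6 * #|fiber_union S C|].
have uT : up_closed S T T.
  by apply/forall_inP => y _; apply/forall_inP => z zT; apply/implyP.
have [PT|] := boolP (#|S| <= 6 * #|fiber_union S T|); last first.
  rewrite -ltnNge => lt; exists T; split => //; first by lia.
  by right => y yT; exact: (finset.bigcup_sup y).
have /(arg_minnP (fun C => #|C|)) [C /and3P[CT uC leC] minC] : P T.
  by rewrite /P fintype.subxx uT.
exists C; split => //; last by left.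
have [->|[c0 c0C]] := set_0Vmem C.
  by rewrite /fiber_union big_set0 cards0 muln0.
have [c cC minc] := exists_smallest_fiber S c0C.
(* By minimality of [C], some clause of [P] fails after removing [c]; closure survives, so it is the
   covering clause. *)
have : ~~ P (C :\ c)%SET.
  by apply/negP => /minC; rewrite (cardsD1 c C) cC; lia.
rewrite /P (fintype.subset_trans _ CT) ?subsetDl //=.
have -> /= : up_closed S T (C :\ c)%SET.
  apply/forall_inP => y /setD1P[_ yC]; apply/forall_inP => z zT.
  apply/implyP => yz; move/forall_inP: uC => /(_ y yC)/forall_inP/(_ z zT).
  rewrite yz /= => zC; rewrite !inE zC andbT; apply/eqP => zc.
  by have := minc y yC; rewrite -zc leqNgt yz.
rewrite -ltnNge => ltD; have := small c (fintype.subsetP CT c cC).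
have : #|fiber_union S C| <= #|fiber S c| + #|fiber_union S (C :\ c)%SET|.
  by rewrite {1}/fiber_union (big_setD1 c cC) /= -/(fiber_union _ _) cardsU leq_subr.
lia.
Qed.

Lemma exists_homogeneous_pair k S T : width_le S T k ->
  homogeneous_pair S T (6 ^ k).
Proof.
elim: k S T => [|k IH] S T w.
  (* A single related pair would already give an antichain of size 1. *)
  apply: homogeneous_pair_self => //; right => x y xS yT.
  apply/negP => rxy; have := w x [set y]%SET xS; rewrite cards1 finset.sub1set.
  suff h : antichain S [set y]%SET.
    by move=> /(_ yT) h'; suff : 1 <= 0 by []; apply: h' => // z /set1P->.
  by move=> z t /set1P-> /set1P->; rewrite eqxx.
have k0 : 0 < 6 ^ k by rewrite expn_gt0.
rewrite expnS; pose Ts := [set y in T | 6 * #|fiber S y| < #|S|]%SET.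
have TsT : Ts \subset T by apply/fintype.subsetP => y; rewrite inE => /andP[].
have [many|few] := leqP #|T| (3 * #|Ts|).
- have [|C [CT uC UC cov]] := @small_fibers_cover S Ts.
    by move=> y; rewrite inE => /andP[].
  pose T1 := [set y in Ts | fiber S y \subset fiber_union S C]%SET.
  pose T2 := [set y in Ts | [forall c in C, incomparable S c y]]%SET.
  have T1T : T1 \subset T.
    by apply: fintype.subset_trans TsT; apply/fintype.subsetP => y /setIdP[].
  have T2T : T2 \subset T.
    by apply: fintype.subset_trans TsT; apply/fintype.subsetP => y /setIdP[].
  have cT : #|Ts| <= #|T1| + #|T2|.
    apply: leq_trans (leq_subr #|T1 :&: T2|%SET _); rewrite -cardsU.
    apply/subset_leq_card/fintype.subsetP => y yT.
    apply/finset.setUP; have [h|h] := up_closed_split uC yT.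
      by left; apply/setIdP.
    by right; apply/setIdP; split => //; apply/forall_inP.
  have [c1|c1] := leqP #|T| (6 * #|T1|).
    apply: (@homogeneous_pairS S (S :\: fiber_union S C)%SET T T1) => //.
    + exact: subsetDl.
    + by rewrite cardsD (finset.setIidPr (fiber_union_sub S C)); lia.
    + apply: homogeneous_pair_self => //; right => x y /setDP[xS xU].
      move=> /setIdP[_ /fintype.subsetP yU]; apply: contra xU => xy.
      by apply: yU; rewrite inE xS.
  have c2 : #|T| <= 6 * #|T2| by lia.
  case: cov => [covS|covT].
    apply: (@homogeneous_pairS S (fiber_union S C) T T2) => //.
      exact: fiber_union_sub.
    by apply: IH; apply: width_le_incomparable => //; exact: width_leS w.
  (* Here every small fiber lies in the union, so [T1] has a third of [T], against [c1]. *)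
  suff : #|Ts| <= #|T1| by lia.
  apply/subset_leq_card/fintype.subsetP => y yT.
  by apply/setIdP; split => //; exact: covT.
- have [L0|[y0 y0L]] := set_0Vmem (T :\: Ts)%SET.
    have := subset_leq_card (_ : T \subset Ts).
    by rewrite -finset.setD_eq0 L0 eqxx => /(_ isT); lia.
  have [y yL miny] := exists_smallest_fiber S y0L.
  pose L := (T :\: Ts)%SET.
  have yU : fiber_union S [set y]%SET = fiber S y by rewrite /fiber_union big_set1.
  pose T1 := [set z in L | fiber S y \subset fiber S z]%SET.
  pose T2 := [set z in L | [forall c in [set y]%SET, incomparable S c z]]%SET.
  have LT : L \subset T by exact: subsetDl.
  have T1T : T1 \subset T.
    by apply: fintype.subset_trans LT; apply/fintype.subsetP => z /setIdP[].
  have T2T : T2 \subset T.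
    by apply: fintype.subset_trans LT; apply/fintype.subsetP => z /setIdP[].
  have cL : #|L| = #|T| - #|Ts| by rewrite cardsD (finset.setIidPr TsT).
  have cT : #|L| <= #|T1| + #|T2|.
    apply: leq_trans (leq_subr #|T1 :&: T2|%SET _); rewrite -cardsU.
    apply/subset_leq_card/fintype.subsetP => z zL.
    apply/finset.setUP; have [h|h] := boolP (fiber S y \subset fiber S z).
      by left; apply/setIdP.
    right; apply/setIdP; split => //; apply/forall_inP => c /set1P->.
    (* A large fiber inside the smallest large one equals it. *)
    rewrite /incomparable h /=; apply: contra h => zy.
    suff -> : fiber S z = fiber S y by [].
    by apply/eqP; rewrite eqEcard zy miny.
  have cS : #|S| <= 6 * #|fiber S y|.
    by case/setDP: yL => yT; rewrite inE yT /= -leqNgt.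
  have [c1|c1] := leqP #|T| (6 * #|T1|).
    apply: (@homogeneous_pairS S (fiber S y) T T1) => //.
      exact: fiber_sub.
    apply: homogeneous_pair_self => //; left => x z xy.
    move=> /setIdP[_ /fintype.subsetP/(_ x xy)].
    by rewrite inE => /andP[].
  (* [L] has over two thirds of [T], and [T1] less than a sixth. *)
  have c2 : #|T| <= 6 * #|T2| by lia.
  apply: (@homogeneous_pairS S (fiber S y) T T2) => //.
    exact: fiber_sub.
  apply: IH; rewrite -yU; apply: width_le_incomparable.
    by rewrite finset.sub1set.
  exact: width_leS w.
Qed.

End FiniteRelation.

(** An antichain with more than [k] elements would supply [k + 1] distinct indices whose fibers
    share a point; an inclusion between two of these fibers in [X] restricts to [A]. *)
Lemma semi_equation1_width_le (X Y : Type) (k : nat) (R : set (X * Y))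
    (A : {fset {classic X}}) (B : {fset {classic Y}}) :
  semi_equation1 k.+1 R ->
  width_le (fun (a : A) (b : B) => `[< R (fsval a, fsval b) >])
    [set: A]%SET [set: B]%SET k.
Proof.
move=> sR x C _ _ xC aC; rewrite leqNgt; apply/negP => kC.
pose y (i : 'I_k.+1) : B := enum_val (widen_ord kC i).
have yinj : injective y.
  by move=> i j /enum_val_inj /(congr1 val) /= ij; exact: val_inj.
have [|i [j [ij yij]]] := sR (fun i => fsval (y i)).
  exists (fsval x) => i _; rewrite /ysection /= inE.
  by apply/asboolP/xC/enum_valP.
have := aC (y i) (y j) (enum_valP _) (enum_valP _).
rewrite (inj_eq yinj) => /(_ (introN eqP ij))/negP; apply.
apply/fintype.subsetP => a; rewrite !inE => aR; apply/asboolP.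
by have := yij (fsval a); rewrite /ysection /= !inE; apply.
Qed.

Theorem theorem1p2 (K : realType) (X Y : Type) (k : nat) (R : set (X * Y)) :
  (0 < k)%N -> semi_equation1 k R -> strong_EH (1 / 6 ^+ (k - 1) : K) R.
Proof.
case: k => // k _; rewrite subn1 /= => sR A B.
have /exists_homogeneous_pair [A0 [B0 [_ _ cA cB h]]] :=
  @semi_equation1_width_le X Y k R A B sR.
exists [fset fsval a | a in A0]%fset, [fset fsval b | b in B0]%fset.
have card_le (m n : nat) : (m <= 6 ^ k * n)%N ->
    1 / 6 ^+ k * m%:R <= n%:R :> K.
  rewrite mul1r mulrC ler_pdivrMr ?exprn_gt0 // mulrC -(ler_nat K).
  by rewrite natrM natrX.
split.
- by apply/fsubsetP => a /imfsetP[a' _ ->]; exact: fsvalP.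
- by apply/fsubsetP => b /imfsetP[b' _ ->]; exact: fsvalP.
- apply: card_le; rewrite card_imfset; last exact: val_inj.
  by rewrite cardsT -cardfE in cA; rewrite -cardE.
- apply: card_le; rewrite card_imfset; last exact: val_inj.
  by rewrite cardsT -cardfE in cB; rewrite -cardE.
- case: h => h; [left; apply/setIidPr|right; apply/seteqP; split => //].
  + move=> [a b] [/= /imfsetP[/= a' aA ->] /imfsetP[/= b' bB ->]].
    exact/asboolP/h.
  + move=> [a b] [Rab [/= /imfsetP[/= a' aA ea] /imfsetP[/= b' bB eb]]].
    by have /asboolPn := h a' b' aA bB; rewrite -ea -eb.
Qed.
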